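(* For every fixed integer $d\ge 2$, as $n\to\infty$, $$\left(\frac{1}{d!} - o_d(1)\right)\frac{n^{d-1}}{\lg n} \;\le\; \frac{\operatorname{mc}_d(n)}{n} \;\le\; \frac{\operatorname{mp}_d(n)}{n} \;\le\; \operatorname{lmp}_d(n) \;\le\; \left(\frac{1}{d!} + o_d(1)\right)\frac{n^{d-1}}{\lg n}.$$
   Context: $\lg$ is the base-2 logarithm. The notation $o_d(1)$ denotes a quantity that tends to $0$ as $n\to\infty$ for each fixed $d$ (the rate may depend on $d$). A $d$-clique is a $d$-uniform hypergraph whose vertex set is a disjoint union $V_1\sqcup\dots\sqcup V_d$ and whose edges are exactly the sets $\{v_1,\dots,v_d\}$ with $v_i\in V_i$ for all $i\in\{1,\dots,d\}$. For a $d$-uniform hypergraph $H$, a $d$-clique covering of $H$ is a family of $d$-cliques that are subhypergraphs of $H$ and whose edge sets have union $E(H)$; it is a $d$-clique partition if these edge sets are moreover pairwise disjoint. The weight of such a family is the sum of the numbers of vertices of its members. Let $\operatorname{mc}_d(H)$ (respectively $\operatorname{mp}_d(H)$) be the minimum weight of a $d$-clique covering (respectively $d$-clique partition) of $H$. Let $\operatorname{lmp}_d(H)$ be the least natural number $\ell$ such that $H$ has a $d$-clique partition in which every vertex of $H$ belongs to at most $\ell$ of the $d$-cliques. Let $\operatorname{mc}_d(n),\operatorname{mp}_d(n),\operatorname{lmp}_d(n)$ be the maxima of $\operatorname{mc}_d(H),\operatorname{mp}_d(H),\operatorname{lmp}_d(H)$ over all $d$-uniform hypergraphs $H$ on $n$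 vertices. *)

(* Defs.v *)
From HB Require Import structures.
From mathcomp Require Import all_boot all_order all_algebra.

Set Implicit Arguments.
Unset Strict Implicit.
Unset Printing Implicit Defensive.

(* A pair (V, E) is a d-uniform hypergraph when E is a set of d-element
   subsets of V. The vertex set is carried explicitly, since the members of a
   covering only span part of the ambient type. *)
Definition uniform (d : nat) (T : finType) (G : {set T} * {set {set T}}) :=
  [forall e in G.2, (e \subset G.1) && (#|e| == d)].

Record uhgraph (d : nat) (T : finType) :=
  UHgraph { uhgraph_val : {set T} * {set {set T}};
            uhgraph_uniform : uniform d uhgraph_val }.

HB.instance Definition _ (d : nat) (T : finType) :=
  [isSub for @uhgraph_val d T].
HB.instance Definition _ (d : nat) (T : finType) :=
  [Finite of uhgraph d T by <:].

Section Cliques.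
Variables (d : nat) (T : finType).
Implicit Types (H K : uhgraph d T) (C : {set uhgraph d T}).

Definition verts H : {set T} := (uhgraph_val H).1.
Definition edges H : {set {set T}} := (uhgraph_val H).2.

Definition subhypergraph K H :=
  (verts K \subset verts H) && (edges K \subset edges H).

(* As the parts are pairwise disjoint, the image [set v i | i : 'I_d] of a
   transversal v has exactly d elements. Parts may be empty. *)
Definition is_clique K :=
  [exists V : {ffun 'I_d -> {set T}},
    [&& [forall i, forall j, (i != j) ==> [disjoint V i & V j]],
        verts K == \bigcup_(i < d) V i
      & edges K == [set [set v i | i : 'I_d]
                     | v : {ffun 'I_d -> T} & [forall i, v i \in V i]]]].

(* Families are sets of cliques: repeating a member never makes a covering
   lighter, nor a partition lighter or of smaller vertex degrees. *)
Definition clique_covering H C :=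
  [forall K in C, is_clique K && subhypergraph K H]
  && (\bigcup_(K in C) edges K == edges H).

Definition clique_partition H C :=
  clique_covering H C &&
  [forall K in C, forall L in C, (K != L) ==> [disjoint edges K & edges L]].

Definition weight C := \sum_(K in C) #|verts K|.

Definition covering_weight H : pred nat := fun w =>
  [exists C : {set uhgraph d T}, clique_covering H C && (weight C == w)].

Definition partition_weight H : pred nat := fun w =>
  [exists C : {set uhgraph d T}, clique_partition H C && (weight C == w)].

Definition local_partition H : pred nat := fun l =>
  [exists C : {set uhgraph d T}, clique_partition H C &&
    [forall x in verts H, #|[set K in C | x \in verts K]| <= l]].

(* The partition into single edges. *)
Definition single_edges H : {set uhgraph d T} :=
  [set K | (verts K \in edges H) && (edges K == [set verts K])].

Lemma edge_sub H e : e \in edges H -> (e \subset verts H) /\ #|e| = d.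
Proof.
move=> eH; have /forallP/(_ e)/implyP/(_ eH) := uhgraph_uniform H.
by case/andP=> ? /eqP.
Qed.

Lemma single_edge_clique K :
  #|verts K| = d -> edges K = [set verts K] -> is_clique K.
Proof.
move=> cK eK; pose f (i : 'I_d) := enum_val (cast_ord (esym cK) i).
have fI : injective f by move=> i j /enum_val_inj /cast_ord_inj.
have imf : [set f i | i : 'I_d] = verts K.
  apply/setP=> x; apply/imsetP/idP => [[i _ ->]|xK]; first exact: enum_valP.
  exists (cast_ord cK (enum_rank_in xK x)) => //.
  by rewrite /f cast_ordK enum_rankK_in.
apply/existsP; exists [ffun i => [set f i]]; apply/and3P; split.
- apply/forallP=> i; apply/forallP=> j; apply/implyP=> ij.
  by rewrite !ffunE disjoints1 inE (inj_eq fI).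
- rewrite -imf; apply/eqP/setP=> x; apply/imsetP/bigcupP.
    by case=> i _ ->; exists i; rewrite // ffunE inE.
  by case=> i _; rewrite ffunE inE => /eqP ->; exists i.
- rewrite eK; apply/eqP/setP=> e; rewrite inE; apply/eqP/imsetP.
    move=> ->; exists [ffun i => f i].
      by rewrite inE; apply/forallP=> i; rewrite !ffunE inE.
    by rewrite -imf; apply: eq_imset => i; rewrite ffunE.
  case=> v; rewrite inE => /forallP vP ->; rewrite -imf.
  by apply: eq_imset => i; have := vP i; rewrite ffunE inE => /eqP.
Qed.

Lemma single_edges_partition H : clique_partition H (single_edges H).
Proof.
apply/andP; split; first (apply/andP; split).
- apply/forallP=> K; apply/implyP; rewrite inE => /andP[KH /eqP eK].
  have [sKH cK] := edge_sub KH.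
  by rewrite single_edge_clique // /subhypergraph sKH eK sub1set.
- apply/eqP/setP=> e; apply/bigcupP/idP.
    by case=> K; rewrite inE => /andP[KH /eqP ->]; rewrite inE => /eqP ->.
  move=> eH; have [_ ce] := edge_sub eH.
  have eU : uniform d (e, [set e]).
    apply/forallP=> e'; apply/implyP; rewrite inE => /eqP ->.
    by rewrite subxx ce eqxx.
  by exists (UHgraph eU); rewrite /edges /= !inE //= /verts /= eH eqxx.
- apply/forallP=> K; apply/implyP; rewrite inE => /andP[_ /eqP eK].
  apply/forallP=> L; apply/implyP; rewrite inE => /andP[_ /eqP eL].
  apply/implyP=> KL; rewrite eK eL disjoints1 inE.
  apply: contraNN KL => /eqP vKL; apply/eqP/val_inj.
  move: vKL eK eL; rewrite /verts /edges /=.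
  case: (uhgraph_val K) => a b; case: (uhgraph_val L) => a' b' /= -> -> ->.
  by [].
Qed.

Lemma covering_weight_ex H : exists w, covering_weight H w.
Proof.
exists (weight (single_edges H)); apply/existsP; exists (single_edges H).
by have /andP[-> _] := single_edges_partition H; rewrite eqxx.
Qed.

Lemma partition_weight_ex H : exists w, partition_weight H w.
Proof.
exists (weight (single_edges H)); apply/existsP; exists (single_edges H).
by rewrite single_edges_partition eqxx.
Qed.

Lemma local_partition_ex H : exists l, local_partition H l.
Proof.
exists #|{: uhgraph d T}|; apply/existsP; exists (single_edges H).
rewrite single_edges_partition; apply/forallP=> x; apply/implyP=> _.
exact: max_card.
Qed.

Definition mc H : nat := ex_minn (covering_weight_ex H).
Definition mp H : nat := ex_minn (partition_weight_ex H).
Definition lmp H : nat := ex_minn (local_partition_ex H).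

End Cliques.

Definition mc_max (d n : nat) : nat :=
  \max_(H : uhgraph d 'I_n | verts H == [set: 'I_n]) mc H.
Definition mp_max (d n : nat) : nat :=
  \max_(H : uhgraph d 'I_n | verts H == [set: 'I_n]) mp H.
Definition lmp_max (d n : nat) : nat :=
  \max_(H : uhgraph d 'I_n | verts H == [set: 'I_n]) lmp H.

(* Required only here because it shadows finset lemma names. *)
From mathcomp Require Import all_classical all_reals all_analysis.

Definition lg (R : realType) (x : R) : R := (ln x / ln 2)%R.

(* Main.v *)
Require Import Defs.
From mathcomp Require Import all_boot zify.

(** Lower bound. A d-clique covering of weight w can be written as a word of
    length w: list the vertices of each clique, each with the index of its part
    and a flag marking the end of the clique. There are (2 d n)^w words of length
    w, and each of the 2^C(n, d) edge sets on n vertices is decoded from a word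
    whose length is the maximal covering weight mc_d(n) (uhgraphs_le_words).
    Hence mc_d(n) is at least C(n, d) / lg (2 d n), which is asymptotic to
    n^d / (d! lg n).

    Comparison. A partition is a covering, and counting incidences of vertices
    and cliques bounds the weight of a partition by n times its largest vertex
    degree.

    Upper bound. Cut the vertices into blocks of size k, where k is slightly less
    than lg n, and group d consecutive blocks into a superblock. Only few edges
    meet some superblock twice; each of them forms a clique by itself. In any
    other edge e one vertex v is chosen as the lead: the one whose rank in e is
    congruent modulo d to the sum of the block indices of the vertices of e. The
    largest of the remaining vertices is the tail w, and U is the set of the
    other d - 2 vertices. Fixing U and v, the fan S collects the vertices of the
    block of w that can replace w. Edges with the same pair (U, S) form a clique
    whose parts are the possible leads, the fan S, and the single vertices of U
    (class_spread).

    It remains to count the cliques at a vertex x (lmp_le). If x is in S or U,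
    there are O(n^(d-2)) choices for U and the block and 2^k choices for S, which
    is negligible since 2^k is o(n / lg n). If x leads, then U and the block of w
    determine S. The rule for the lead makes the block of w a function of U and
    of the superblock of w (lead_blk), and as w is larger than all of U, a pair
    of U and a superblock above it accounts for d k different (d-1)-sets
    (card_leader_keys). So x leads at most about C(n, d-1) / (d k) cliques, which
    is asymptotic to n^(d-1) / (d! lg n). *)

Set Implicit Arguments.
Unset Strict Implicit.
Unset Printing Implicit Defensive.

(** * Counting subsets *)

Lemma card_bigcup_le (I T : finType) (A : {set I}) (F : I -> {set T}) b :
  (forall i, i \in A -> #|F i| <= b) -> #|\bigcup_(i in A) F i| <= #|A| * b.
Proof.
move=> Fb; rewrite -sum_nat_const.
elim/big_rec2: _ => [|i m B iA leB]; first by rewrite cards0.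
by rewrite (leq_trans (leq_card_setU _ _)) // leq_add // Fb.
Qed.

Lemma ffact_le_exp n j : n ^_ j <= n ^ j.
Proof.
rewrite ffact_prod -[X in n ^ X]card_ord -prod_nat_const.
by apply: leq_prod => i _; apply: leq_subr.
Qed.

Lemma bin_le_exp n j : 'C(n, j) <= n ^ j.
Proof.
apply: leq_trans (leq_pmulr _ (fact_gt0 j)) _.
by rewrite bin_ffact ffact_le_exp.
Qed.

Lemma card_divn_class n q b : 0 < b -> #|[set y : 'I_n | y %/ b == q]| <= b.
Proof.
move=> b0; have f_inj : {in [set y : 'I_n | y %/ b == q] &,
    injective (fun y : 'I_n => Ordinal (ltn_pmod y b0))}.
  move=> y z; rewrite !inE => /eqP yq /eqP zq [eqm]; apply: val_inj => /=.
  by rewrite (divn_eq y b) (divn_eq z b) eqm yq zq.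
by rewrite -(card_in_imset f_inj) -[leqRHS]card_ord max_card.
Qed.

(** Of the j elements only j - 1 are free, which gains a factor #|T|. The
    product form also covers j = 0, where no such set exists. *)
Lemma card_draws_mem (T : finType) (x : T) j :
  #|[set U : {set T} | (#|U| == j) && (x \in U)]| * #|T| <= #|T| ^ j.
Proof.
set A := [set U : {set T} | _].
have inj : {in A &, injective (fun U => U :\ x)}.
  move=> U V; rewrite !inE => /andP[_ xU] /andP[_ xV] eqUV.
  by rewrite -(setD1K xU) -(setD1K xV) eqUV.
case: j => [|j] in A inj *.
  suff -> : A = set0 by rewrite cards0.
  by apply/setP=> U; rewrite !inE; apply/andP=> -[/eqP/cards0_eq ->]; rewrite inE.
rewrite expnSr leq_mul // -(card_in_imset inj).
rewrite (leq_trans _ (bin_le_exp _ _)) // -card_draws.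
apply/subset_leq_card/subsetP=> _ /imsetP[U /[!inE]/andP[/eqP cU xU] ->].
by rewrite -eqSS -cU (cardsD1 x U) xU.
Qed.

(** * Clique partitions from edge labels *)

Section Partitions.
Variables (d : nat) (T : finType) (H : uhgraph d T).

Definition transversals (V : 'I_d -> {set T}) : {set {set T}} :=
  [set [set v i | i : 'I_d]
     | v : {ffun 'I_d -> T} & [forall i, v i \in V i]].

Lemma eq_transversals (V V' : 'I_d -> {set T}) :
  V =1 V' -> transversals V = transversals V'.
Proof.
move=> eqV; have eqP v : [forall i, v i \in V i] = [forall i, v i \in V' i].
  by apply: eq_forallb => i; rewrite eqV.
by apply/setP=> e; apply/imsetP/imsetP=> -[v vV ->]; exists v => //;
  move: vV; rewrite !inE eqP.
Qed.

Lemma sub_uniform (E : {set {set T}}) :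
  E \subset edges H -> uniform d (cover E, E).
Proof.
move=> /subsetP EH; apply/forallP=> e; apply/implyP=> eE.
have [_ /= ->] := edge_sub (EH _ eE); rewrite eqxx andbT.
by apply: (bigcup_max e).
Qed.

(** As soon as one transversal exists, every element of every part extends to
    a transversal: no vertex of a clique with edges is isolated. *)
Lemma cover_transversals (V : 'I_d -> {set T}) :
  transversals V != set0 -> cover (transversals V) = \bigcup_i V i.
Proof.
case/set0Pn=> _ /imsetP[v /[!inE]/forallP vV _]; apply/setP=> x.
apply/bigcupP/bigcupP => [[_ /imsetP[u /[!inE]/forallP uV ->]]|[i _ xi]].
  by case/imsetP=> i _ ->; exists i.
exists [set (if j == i then x else v j) | j : 'I_d]; last first.
  by apply/imsetP; exists i; rewrite // eqxx.
apply/imsetP; exists [ffun j => if j == i then x else v j].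
  by rewrite inE; apply/forallP=> j; rewrite ffunE; case: eqP => // ->.
by apply: eq_imset => j; rewrite ffunE.
Qed.

(** Labelling the edges by keys partitions them into the classes of equal key.
    If each class is the edge set of a clique, the number of cliques at x is the
    number of keys occurring at x, so bounding local degrees amounts to counting
    keys. *)
Lemma lmp_keys (KT : finType) (key : {set T} -> KT) l :
  (forall e, e \in edges H -> exists V : 'I_d -> {set T},
     (forall i j, i != j -> [disjoint V i & V j]) /\
     [set f in edges H | key f == key e] = transversals V) ->
  (forall x, #|[set key e | e in edges H & x \in e]| <= l) ->
  lmp H <= l.
Proof.
move=> keyP keyl.
pose cls c := [set f in edges H | key f == c].
have clsU c : uniform d (cover (cls c), cls c).
  by apply: sub_uniform; apply/subsetP=> f; rewrite inE => /andP[].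
pose K c := UHgraph (clsU c); pose C := [set K (key e) | e in edges H].
have memcls e : e \in edges H -> e \in cls (key e) by rewrite inE eqxx andbT.
rewrite /lmp; case: ex_minnP => m _; apply; apply/existsP; exists C.
apply/andP; split; [apply/andP; split; [apply/andP; split|]|].
- apply/forall_inP=> _ /imsetP[e eH ->]; have [V [Vd clsV]] := keyP e eH.
  rewrite /subhypergraph; apply/and3P; split; last first.
  + by apply/subsetP=> f; rewrite inE => /andP[].
  + apply/bigcupsP=> f /[!inE]/andP[fH _].
    by have [] := edge_sub fH.
  apply/existsP; exists (finfun V); apply/and3P; split.
  + apply/forallP=> i; apply/forallP=> j; apply/implyP=> ij.
    by rewrite !ffunE Vd.
  + rewrite /verts /= /cls clsV cover_transversals; last first.
      by rewrite -clsV; apply/set0Pn; exists e; apply: memcls.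
    by apply/eqP/eq_bigr=> i _; rewrite ffunE.
  + rewrite /edges /= /cls clsV; apply/eqP.
    by apply: eq_transversals => i; rewrite ffunE.
- apply/eqP/setP=> e; apply/bigcupP/idP => [[_ /imsetP[f fH ->]]|eH].
    by rewrite inE => /andP[].
  by exists (K (key e)); [apply: imset_f|apply: memcls].
- apply/forall_inP=> _ /imsetP[e eH ->].
  apply/forall_inP=> _ /imsetP[f fH ->]; apply/implyP=> ne.
  rewrite disjoints_subset; apply/subsetP=> g /[!inE]/andP[gH /eqP ge].
  rewrite gH /=; apply: contraNN ne => /eqP gf.
  by rewrite -ge gf.
- apply/forall_inP=> x _; apply: leq_trans (keyl x).
  apply: leq_trans (leq_imset_card K _); apply/subset_leq_card/subsetP=> L.
  rewrite inE => /andP[/imsetP[e eH ->]] /bigcupP[f /[!inE]/andP[fH /eqP fe] xf].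
  by apply: imset_f; apply/imsetP; exists f; rewrite // !inE fH.
Qed.

End Partitions.

(** The shape of all cliques used for the upper bound: two large parts A and S,
    and d - 2 parts that are the single vertices of U. *)
Lemma fan_transversals d (T : finType) (A S U : {set T}) :
  1 < d -> #|U| = d - 2 -> [disjoint A & S] -> [disjoint A & U] ->
  [disjoint S & U] ->
  exists V : 'I_d -> {set T}, (forall i j, i != j -> [disjoint V i & V j]) /\
    transversals V = [set v |: (w |: U) | v in A, w in S].
Proof.
move=> d1 cU dAS dAU dSU.
(* An element of A is the default value of nth; without one both sides are
   empty. *)
have [A0|[a0 _]] := set_0Vmem A.
  exists (fun _ => set0); split=> [i j _|]; first by rewrite -setI_eq0 set0I.
  apply/setP=> e; apply/imsetP/imset2P => [[v /[!inE]/forallP/(_ (Ordinal d1))]|].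
    by rewrite inE.
  by case=> v w; rewrite A0 inE.
pose u j := nth a0 (enum U) j.
have u_mem j : j < d - 2 -> u j \in U.
  by move=> jd; rewrite -mem_enum mem_nth // -cardE cU.
have memU x : x \in U -> exists2 j, j < d - 2 & x = u j.
  rewrite -mem_enum => xU; exists (index x (enum U)).
    by rewrite -cU cardE index_mem.
  by rewrite /u nth_index.
pose B (S' A' : {set T}) j : {set T} :=
  match j with 0 => A' | 1 => S' | j'.+2 => [set u j'] end.
have dB i j : i < d -> j < d -> i != j -> [disjoint B S A i & B S A j].
  wlog: i j / i < j => [wl|].
    case: (ltngtP i j) => [ij id jd _|ji id jd _|] //.
      by apply: wl => //; rewrite neq_ltn ij.
    by rewrite disjoint_sym wl // neq_ltn ji.
  case: i j => [|[|i]] [|[|j]] //= ij id jd ne.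
  - by rewrite disjoint_sym disjoints1 (disjointFl dAU) ?u_mem //; lia.
  - by rewrite disjoint_sym disjoints1 (disjointFl dSU) ?u_mem //; lia.
  - rewrite disjoints1 inE nth_uniq ?enum_uniq // -?cardE ?cU; lia.
exists (fun i => B S A i); split=> [i j ne|]; first by apply: dB.
have d0 : 0 < d by lia.
apply/setP=> e; apply/imsetP/imset2P => [[v /[!inE]/forallP vV ->]|].
  exists (v (Ordinal d0)) (v (Ordinal d1)); first exact: (vV (Ordinal d0)).
    exact: (vV (Ordinal d1)).
  apply/setP=> x; rewrite !inE; apply/imsetP/idP=> [[[[|[|i]] id] _ ->]|].
  - by rewrite (bool_irrelevance id d0) eqxx.
  - by rewrite (bool_irrelevance id d1) eqxx orbT.
  - have := vV (Ordinal id); rewrite /= inE => /eqP ->.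
    by rewrite u_mem ?orbT //; lia.
  case/or3P=> [/eqP ->|/eqP ->|/memU[j jd ->]]; [by eexists|by eexists|].
  have jd2 : j.+2 < d by lia.
  by exists (Ordinal jd2) => //; have := vV (Ordinal jd2); rewrite /= inE => /eqP.
case=> v w vA wS ->; exists [ffun i : 'I_d => match val i with
    0 => v | 1 => w | j.+2 => u j end].
  by rewrite inE; apply/forallP=> -[[|[|i]] id]; rewrite ffunE //= inE.
apply/setP=> x; rewrite !inE; apply/idP/imsetP=> [|[[[|[|i]] id] _ ->]].
- case/or3P=> [/eqP ->|/eqP ->|/memU[j jd ->]].
  + by exists (Ordinal d0); rewrite // ffunE.
  + by exists (Ordinal d1); rewrite // ffunE.
  + have jd2 : j.+2 < d by lia.
    by exists (Ordinal jd2); rewrite // ffunE.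
- by rewrite ffunE eqxx.
- by rewrite ffunE eqxx orbT.
- by rewrite ffunE /= u_mem ?orbT //; lia.
Qed.

(** * Leads and tails of edges *)

Section Roles.
Variables (d k n : nat).
Hypothesis d1 : 1 < d.
Implicit Types (x y z v w : 'I_n) (e f : {set 'I_n}).

Definition blk x := x %/ k.
(** A superblock consists of d consecutive blocks, whose indices represent all
    residues modulo d. *)
Definition sblk x := x %/ (k * d).

Definition spread e :=
  [forall x in e, forall y in e, (sblk x == sblk y) ==> (x == y)].

Definition rank e x := \sum_(y in e) (y < x : nat).

(** The ranks in e of the vertices of an edge e run through all residues modulo
    d, so the sum of block indices selects exactly one of them. Moving another
    vertex between the d blocks of its superblock, without changing any rank,
    shifts the sum through all residues: each vertex leads for an exact fraction
    1/d of the choices. *)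
Definition lead e x := (x \in e) && (rank e x == \sum_(y in e) blk y %[mod d]).

Definition tail e w :=
  [&& w \in e, ~~ lead e w & [forall y in e, ~~ lead e y ==> (y <= w)]].

Definition rest e := [set y in e | ~~ lead e y && ~~ tail e y].

Let d0 : 0 < d. Proof. lia. Qed.

Lemma blk_sblk x y : blk x = blk y -> sblk x = sblk y.
Proof. by rewrite /sblk !divnMA /blk => ->. Qed.

Lemma sblk_lt x y : sblk x < sblk y -> x < y.
Proof. by apply: contraTT; rewrite -!leqNgt; apply: leq_div2r. Qed.

Lemma spreadP e :
  reflect {in e &, injective sblk} (spread e).
Proof.
apply: (iffP forall_inP) => [eP x y xe ye eq|eP x xe].
  by have /forall_inP/(_ y ye) := eP x xe; rewrite eq eqxx => /eqP.
by apply/forall_inP=> y ye; apply/implyP=> /eqP/eP ->.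
Qed.

Lemma rank_lt e x y : x \in e -> x < y -> rank e x < rank e y.
Proof.
move=> xe xy; rewrite /rank (big_setD1 x xe) [ltnRHS](big_setD1 x xe) /=.
rewrite ltnn xy add0n add1n ltnS; apply: leq_sum => z _.
by case: (ltnP z x) => // zx; rewrite (ltn_trans zx xy).
Qed.

Lemma rank_max e x : x \in e -> rank e x < #|e|.
Proof.
move=> xe; rewrite /rank (big_setD1 x xe) /= ltnn (cardsD1 x e) xe ltnS.
by rewrite -sum1_card leq_sum // => z _; apply: leq_b1.
Qed.

Lemma rank_inj e : {in e &, injective (rank e)}.
Proof.
move=> x y xe ye eq; apply: val_inj; case: (ltngtP x y) => // lt.
  by have := rank_lt xe lt; rewrite eq ltnn.
by have := rank_lt ye lt; rewrite eq ltnn.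
Qed.

Lemma lead_uniq e x y : #|e| = d -> lead e x -> lead e y -> x = y.
Proof.
move=> ce /andP[xe /eqP rx] /andP[ye /eqP ry]; apply: (rank_inj xe ye).
have := etrans rx (esym ry).
by rewrite !modn_small // -ce rank_max.
Qed.

Lemma lead_ex e : #|e| = d -> exists x, lead e x.
Proof.
move=> ce; pose f x := Ordinal (ltn_pmod (rank e x) d0).
have fI : {in e &, injective f}.
  move=> x y xe ye [].
  by rewrite !modn_small -?ce ?rank_max //; apply: rank_inj.
have fT : f @: e = setT.
  by apply/eqP; rewrite eqEcard subsetT cardsT card_ord (card_in_imset fI) ce /=.
have : Ordinal (ltn_pmod (\sum_(y in e) blk y) d0) \in f @: e by rewrite fT.
by case/imsetP=> x xe [eq]; exists x; rewrite /lead xe eq eqxx.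
Qed.

Lemma tail_uniq e x y : tail e x -> tail e y -> x = y.
Proof.
move=> /and3P[xe lx /forall_inP xm] /and3P[ye ly /forall_inP ym].
apply/val_inj/eqP; rewrite eqn_leq (implyP (ym x xe)) //.
by rewrite (implyP (xm y ye)).
Qed.

Lemma tail_ex e : #|e| = d -> exists w, tail e w.
Proof.
move=> ce; have [v lv] := lead_ex ce.
have : 0 < #|e :\ v|.
  have /andP[ve _] := lv.
  have cD : d = #|e :\ v|.+1 by rewrite -ce (cardsD1 v e) ve.
  by rewrite -ltnS -cD.
case/card_gt0P=> w0 w0e.
case: (arg_maxnP (fun x : 'I_n => x : nat) w0e) => w wD wm.
have /setD1P[wv we] : w \in e :\ v by [].
exists w; rewrite /tail we; apply/and3P; split=> //.
  by apply: contraNN wv => lw; rewrite (lead_uniq ce lw lv).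
apply/forall_inP=> y ye; apply/implyP=> ly; apply: wm.
by apply/setD1P; split=> //; apply: contraNneq ly => ->.
Qed.

Lemma edge_roles e v w : #|e| = d -> lead e v -> tail e w ->
  [/\ e = v |: (w |: rest e), v != w, v \notin rest e, w \notin rest e
    & #|rest e| = d - 2].
Proof.
move=> ce lv tw; have /andP[ve _] := lv; have /and3P[we lw _] := tw.
have vw : v != w by apply: contraNneq lw => <-.
have vr : v \notin rest e by rewrite inE lv andbF.
have wr : w \notin rest e by rewrite inE tw !andbF.
have eE : e = v |: (w |: rest e).
  apply/setP=> x; rewrite !inE; apply/idP/or3P => [xe|[/eqP->|/eqP->|/andP[]] //].
  have [lx|lx] := boolP (lead e x).
    by apply: Or31; rewrite (lead_uniq ce lx lv).
  have [tx|tx] := boolP (tail e x); first by apply: Or32; rewrite (tail_uniq tx tw).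
  by apply: Or33; rewrite xe.
split=> //; have := ce; rewrite {1}eE !cardsU1 wr !inE negb_or vw; move: vr.
by rewrite !inE => -> /=; lia.
Qed.

Lemma sum_roles e v w (F : 'I_n -> nat) : #|e| = d -> lead e v -> tail e w ->
  \sum_(y in e) F y = F v + (F w + \sum_(y in rest e) F y).
Proof.
move=> ce lv tw; have [eE vw vr wr _] := edge_roles ce lv tw.
rewrite [in LHS]eE big_setU1 ?big_setU1 //.
by rewrite in_setU1 negb_or vw.
Qed.

(** Since x and y share a superblock that avoids z, they lie on the same side
    of z. *)
Lemma sblk_neq_lt x y z : sblk x = sblk y -> sblk x != sblk z -> (x < z) = (y < z).
Proof.
move=> xy; rewrite neq_ltn => /orP[lt|lt].
  by rewrite !sblk_lt // -xy.
have lt' : sblk z < sblk y by rewrite -xy.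
by rewrite [LHS]ltnNge [RHS]ltnNge (ltnW (sblk_lt lt)) (ltnW (sblk_lt lt')).
Qed.

(** The residue of the block index of the tail is forced by the lead, the rest
    and the superblock of the tail, because these determine the rank of the lead
    and all other block indices. A superblock contains each residue once, so the
    whole block is determined. This is where the factor 1/d is gained. *)
Lemma lead_blk e f v w w' :
  #|e| = d -> spread e -> lead e v -> tail e w ->
  #|f| = d -> lead f v -> tail f w' ->
  rest e = rest f -> sblk w = sblk w' -> blk w = blk w'.
Proof.
move=> ce se lv tw cf lv' tw' ref sw.
have [_ vw _ _ _] := edge_roles ce lv tw.
have /andP[ve /eqP rv] := lv; have /andP[_ /eqP rv'] := lv'.
have we : w \in e by case/and3P: tw.
have sv : sblk w != sblk v.
  by apply: contraNneq vw => /esym/(spreadP _ se v w ve we) ->.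
move: rv rv'; rewrite /rank !(sum_roles _ ce lv tw) !(sum_roles _ cf lv' tw').
rewrite -!ref (sblk_neq_lt sw sv) => -> /eqP; rewrite eqn_modDl eqn_modDr => /eqP rw.
rewrite (divn_eq (blk w) d) (divn_eq (blk w') d) rw /blk -!divnMA.
by move: sw; rewrite /sblk => ->.
Qed.

Lemma rest_sblk_lt e w y : spread e -> tail e w -> y \in rest e -> sblk y < sblk w.
Proof.
move=> se /and3P[we lw /forall_inP wm].
rewrite inE => /and3P[ye ly ty].
have yw : y != w.
  by apply: contraNneq ty => ->; rewrite /tail we lw; apply/forall_inP.
have : y <= w by have /implyP/(_ ly) := wm y ye.
move/(leq_div2r (k * d)); rewrite leq_eqVlt => /orP[/eqP eq|//].
by rewrite (spreadP _ se y w ye we eq) eqxx in yw.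
Qed.

Lemma restE e v w : #|e| = d -> lead e v -> tail e w ->
  rest e = e :\ w :\ v.
Proof.
move=> ce lv tw; apply/setP=> x; rewrite !inE.
have -> : lead e x = (x == v).
  by apply/idP/eqP=> [lx|-> //]; apply: lead_uniq lx lv.
have -> : tail e x = (x == w).
  by apply/idP/eqP=> [tx|-> //]; apply: tail_uniq tx tw.
by rewrite andbC -andbA andbCA andbA.
Qed.

(** Replacing the tail inside its block changes neither the ranks of the other
    vertices nor the sum of block indices, so all roles are kept. *)
Lemma swap_tail e v w w' (e' := w' |: e :\ w) :
  #|e| = d -> spread e -> lead e v -> tail e w -> blk w' = blk w ->
  [/\ [/\ #|e'| = d, spread e' & e' :\ w' = e :\ w],
    lead e' v, tail e' w' & rest e' = rest e].
Proof.
move=> ce tr lv tw bw; have /and3P[we lw /forall_inP wm] := tw.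
have sw := blk_sblk bw.
have [ww'|w'we] := eqVneq w' w.
  by rewrite /e' ww' setD1K //; split.
have trP := spreadP e tr.
have w'e : w' \notin e.
  by apply: contraNN w'we => w'e; rewrite (trP _ _ w'e we sw).
have w'D : w' \notin e :\ w by rewrite inE (negPf w'e) andbF.
have e'D : e' :\ w' = e :\ w by rewrite setU1K.
have ce' : #|e'| = d by rewrite cardsU1 w'D -ce (cardsD1 w e) we.
have ltw x : x \in e :\ w -> (w' < x) = (w < x).
  case/setD1P=> xw xe; apply: sblk_neq_lt => //; rewrite sw.
  by apply: contraNneq xw => eq; rewrite (trP w x we xe eq).
have leadE x : x \in e :\ w -> lead e' x = lead e x.
  move=> xD; have /setD1P[xw xe] := xD; rewrite /lead xe.
  have sumE (F : 'I_n -> nat) : F w' = F w ->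
      \sum_(y in e') F y = \sum_(y in e) F y.
    by move=> Fw; rewrite (big_setU1 _ w'D) (big_setD1 w we) /= Fw.
  rewrite /rank in_setU1 xD orbT sumE; last by rewrite ltw.
  by rewrite sumE.
have vD : v \in e :\ w.
  by apply/setD1P; split; [apply: contraNneq lw => <-|case/andP: lv].
have lv' : lead e' v by rewrite leadE.
have lw' : ~~ lead e' w'.
  by apply: contraNN w'D => lw'; rewrite (lead_uniq ce' lw' lv').
have w'e' : w' \in e' by rewrite setU11.
have tr' : spread e'.
  apply/spreadP=> x y; rewrite !in_setU1 => /orP[/eqP->|xD] /orP[/eqP->|yD] //.
  - by rewrite sw => /esym; case/setD1P: yD => yw ye /trP yE;
      rewrite yE ?eqxx // in yw.
  - by rewrite sw; case/setD1P: xD => xw xe /trP xE;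
      rewrite xE ?eqxx // in xw.
  - by case/setD1P: xD => _ xe; case/setD1P: yD => _ ye; apply: trP.
have tw' : tail e' w'.
  rewrite /tail w'e' lw'; apply/forall_inP=> y; rewrite in_setU1.
  case/predU1P=> [->|yD]; first by rewrite leqnn implybT.
  apply/implyP; rewrite leadE // => ly.
  have /setD1P[yw ye] := yD.
  have /implyP/(_ ly) := wm y ye; rewrite leqNgt -ltw // -leqNgt //.
split=> //.
by rewrite (restE ce lv tw) (restE ce' lv' tw') e'D.
Qed.

End Roles.

(** * The partition and its local degrees *)

Section Upper.
Variables (d k n : nat).
Hypotheses (d1 : 1 < d) (k0 : 0 < k).
Variable H : uhgraph d 'I_n.
Implicit Types (x y z v w : 'I_n) (e f U S : {set 'I_n}).

Local Notation blk := (blk k).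
Local Notation sblk := (sblk d k).
Local Notation lead := (lead d k).
Local Notation tail := (tail d k).
Local Notation rest := (rest d k).
Local Notation spread := (spread d k).

(** The vertices that may replace the tail of e within its block. *)
Definition fan e : {set 'I_n} :=
  [set z | [exists w, [&& tail e w, blk z == blk w & z |: e :\ w \in edges H]]].

(** An edge that meets some superblock twice is a clique of its own. The empty
    second component tells its key from the others, as a fan contains the tail.
    For the other edges the key determines the block of the tail, so that edges
    with equal keys differ only in their lead and in the choice of a tail in the
    common fan. *)
Definition key e : {set 'I_n} * {set 'I_n} :=
  if spread e then (rest e, fan e) else (e, set0).

Let card_edge e : e \in edges H -> #|e| = d.
Proof. by move=> eH; have [] := edge_sub eH. Qed.

Lemma in_fan e w z : tail e w ->
  (z \in fan e) = (blk z == blk w) && (z |: e :\ w \in edges H).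
Proof.
move=> tw; rewrite inE; apply/existsP/andP => [[y /and3P[ty bz zH]]|[bz zH]].
  by rewrite (tail_uniq tw ty).
by exists w; rewrite tw bz.
Qed.

Lemma tail_fan e w : e \in edges H -> tail e w -> w \in fan e.
Proof.
move=> eH tw; rewrite (in_fan _ tw) eqxx setD1K //.
by case/and3P: tw.
Qed.

Lemma key_spread e f : e \in edges H -> spread e ->
  f \in edges H -> key f = key e -> spread f.
Proof.
move=> eH te fH; rewrite /key te; case: ifP => // _ [_ e0].
have [w tw] := tail_ex k d1 (card_edge eH).
by have := tail_fan eH tw; rewrite -e0 inE.
Qed.

Lemma swap_key e v w z : e \in edges H -> spread e -> lead e v ->
  tail e w -> z \in fan e ->
  [/\ z |: e :\ w \in edges H, key (z |: e :\ w) = key e,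
      lead (z |: e :\ w) v & tail (z |: e :\ w) z].
Proof.
move=> eH te lv tw zf; have ce := card_edge eH.
have := zf; rewrite (in_fan _ tw) => /andP[/eqP bz zH].
have [[_ te' De'] lv' tw' re'] := swap_tail ce te lv tw bz.
split=> //; rewrite /key te te' re'; congr pair.
by apply/setP=> y; rewrite (in_fan _ tw) (in_fan _ tw') De' bz.
Qed.

(** The class of e is the clique with parts A (the leads occurring in the
    class), the fan of e, and the single vertices of its rest. Any lead v in A
    comes with its own edge, whose fan is the same; hence every vertex of that
    fan completes v and the rest to an edge, and swapping tails keeps the key. *)
Lemma class_spread e : e \in edges H -> spread e ->
  exists V : 'I_d -> {set 'I_n},
    (forall i j, i != j -> [disjoint V i & V j]) /\
    [set f in edges H | key f == key e] = transversals V.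
Proof.
move=> eH te; pose U := rest e; pose S := fan e.
pose A := [set v | [exists f in edges H, (key f == key e) && lead f v]].
have keyE f : f \in edges H -> key f = key e ->
    [/\ spread f, rest f = U & fan f = S].
  move=> fH kf; have tf := key_spread eH te fH kf; split=> //;
  by move: kf; rewrite /key te tf => -[].
have inA v : reflect (exists f, [/\ f \in edges H, key f = key e & lead f v])
                     (v \in A).
  rewrite inE; apply: (iffP exists_inP) => [[f fH /andP[/eqP kf lf]]|].
    by exists f.
  by case=> f [fH kf lf]; exists f => //; rewrite kf eqxx.
have [w0 tw0] := tail_ex k d1 (card_edge eH).
have SP y z : y \in S -> z \in S -> blk y = blk z.
  by rewrite !(in_fan _ tw0) => /andP[/eqP -> _] /andP[/eqP -> _].
have dSf f v y : f \in edges H -> key f = key e -> v \in f -> ~~ tail f v ->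
    y \in S -> v != y.
  move=> fH kf vf tv yS; have [tf _ Sf] := keyE f fH kf.
  have [w tw] := tail_ex k d1 (card_edge fH).
  have wS : w \in S by rewrite -Sf tail_fan.
  apply: contraNneq tv => vy; have vw : v = w.
    apply: (spreadP _ _ _ tf) => //; first by case/and3P: tw.
    by apply: blk_sblk; apply: SP => //; rewrite vy.
  by rewrite vw.
have cU : #|U| = d - 2.
  have [v lv] := lead_ex k d1 (card_edge eH).
  by have [] := edge_roles d1 (card_edge eH) lv tw0.
have dAS : [disjoint A & S].
  rewrite disjoints_subset; apply/subsetP=> v /inA[f [fH kf lv]].
  rewrite inE; apply/negP=> vS.
  suff : v != v by rewrite eqxx.
  have /andP[vf _] := lv.
  by apply: (dSf f) => //; apply/negP => /and3P[_]; rewrite lv.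
have dAU : [disjoint A & U].
  rewrite disjoints_subset; apply/subsetP=> v /inA[f [fH kf lv]].
  have [_ <- _] := keyE f fH kf.
  by rewrite !inE lv andbF.
have dSU : [disjoint S & U].
  rewrite disjoint_sym disjoints_subset; apply/subsetP=> v vU.
  rewrite inE; apply/negP=> vS.
  suff : v != v by rewrite eqxx.
  move: vU; rewrite inE => /and3P[ve _ tv].
  by apply: (dSf e).
have [V [dV VE]] := fan_transversals d1 cU dAS dAU dSU.
exists V; split=> //; rewrite VE; apply/setP=> f; apply/idP/imset2P.
  rewrite inE => /andP[fH /eqP kf]; have [tf rf ff] := keyE f fH kf.
  have [v lv] := lead_ex k d1 (card_edge fH).
  have [w tw] := tail_ex k d1 (card_edge fH).
  exists v w; first by apply/inA; exists f.
    by rewrite -ff tail_fan.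
  by rewrite -rf; have [] := edge_roles d1 (card_edge fH) lv tw.
case=> v z /inA[g [gH kg lv]] zS ->.
have [tg rg fg] := keyE g gH kg.
have [w tw] := tail_ex k d1 (card_edge gH).
have zg : z \in fan g by rewrite fg.
have [zH kz lz tz] := swap_key gH tg lv tw zg.
have [eqz _ _ _ _] := edge_roles d1 (card_edge zH) lz tz.
have [_ rz _] := keyE _ zH (etrans kz kg).
by rewrite inE -rz -eqz zH kz kg eqxx.
Qed.

Lemma class_single e : e \in edges H -> ~~ spread e ->
  exists V : 'I_d -> {set 'I_n},
    (forall i j, i != j -> [disjoint V i & V j]) /\
    [set f in edges H | key f == key e] = transversals V.
Proof.
move=> eH te; have ce := card_edge eH.
have [v lv] := lead_ex k d1 ce; have [w tw] := tail_ex k d1 ce.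
have [eE vw vr wr cr] := edge_roles d1 ce lv tw.
have [||| V [dV VE]] := @fan_transversals d _ [set v] [set w] (rest e) d1 cr.
- by rewrite disjoints1 inE.
- by rewrite disjoints1.
- by rewrite disjoints1.
exists V; split=> //; rewrite VE; apply/setP=> f.
transitivity (f == e); last first.
  apply/eqP/imset2P => [->|[_ _ /set1P-> /set1P-> ->] //].
  by exists v w; rewrite ?set11.
rewrite inE; apply/andP/eqP=> [[fH /eqP kf]|-> //].
have tf : ~~ spread f.
  by apply: contraNN te => tf; apply: (key_spread fH).
by move: kf; rewrite /key (negPf te) (negPf tf) => -[].
Qed.

Lemma lmp_le_keys l :
  (forall x, #|[set key e | e in edges H & x \in e]| <= l) -> lmp H <= l.
Proof.
apply: lmp_keys => e eH.
by have [te|te] := boolP (spread e); [apply: class_spread|apply: class_single].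
Qed.

(** Removing from such an edge x and a vertex y sharing its superblock with
    another vertex leaves d - 2 free vertices, and few choices for y. *)
Lemma card_nonspread x :
  #|[set e in edges H | (x \in e) && ~~ spread e]|
    <= n ^ (d - 2) * (d.-1 * (k * d)).
Proof.
have kd0 : 0 < k * d by rewrite muln_gt0 k0; lia.
pose near Z : {set 'I_n} := \bigcup_(z in x |: Z) [set y | sblk y == sblk z].
pose B := \bigcup_(Z in [set Z : {set 'I_n} | #|Z| == d - 2])
  [set x |: (y |: Z) | y in near Z].
have leB : #|B| <= n ^ (d - 2) * (d.-1 * (k * d)).
  apply: (leq_trans (card_bigcup_le (b := d.-1 * (k * d)) _)); last first.
    by rewrite leq_mul // card_draws card_ord bin_le_exp.
  move=> Z /[!inE]/eqP cZ; apply: leq_trans (leq_imset_card _ _) _.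
  apply: (leq_trans (card_bigcup_le (b := k * d) _)); last first.
    by rewrite leq_mul // cardsU1 cZ; case: (_ \notin _); lia.
  by move=> z _; apply: card_divn_class.
apply: leq_trans leB; apply/subset_leq_card/subsetP=> e.
rewrite inE => /and3P[eH xe /forall_inPn[y ye /forall_inPn[z ze]]].
rewrite negb_imply => /andP[/eqP syz yz].
wlog yx : y z ye ze syz yz / y != x => [wl|].
  have [yx|yx] := eqVneq y x; last exact: (wl y z).
  by apply: (wl z y) => //; rewrite 1?eq_sym // -yx.
have eE : e = x |: (y |: e :\ x :\ y).
  by rewrite (setD1K (_ : y \in e :\ x)) ?setD1K // !inE yx.
apply/bigcupP; exists (e :\ x :\ y).
  rewrite inE; have := card_edge eH; rewrite (cardsD1 x e) xe.
  by rewrite (cardsD1 y (e :\ x)) !inE yx ye /= => <-; apply/eqP; lia.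
apply/imsetP; exists y => //; apply/bigcupP; exists z; last by rewrite inE syz.
by rewrite !inE ze andbT [z == y]eq_sym yz; case: (z == x).
Qed.

Lemma fan_sub e w : tail e w -> fan e \subset [set y | blk y == blk w].
Proof.
by move=> tw; apply/subsetP=> z; rewrite (in_fan _ tw) inE => /andP[].
Qed.

Lemma card_block_powerset q :
  #|powerset [set y : 'I_n | y %/ k == q]| <= 2 ^ k.
Proof. by rewrite card_powerset leq_exp2l // card_divn_class. Qed.

(** If x is the tail, its block is known; if x is in the rest, one fewer vertex
    is free but the block is not known. Either way the rest and the block allow
    at most n ^ (d - 2) choices, and each block has at most 2 ^ k subsets. *)
Lemma card_follower_keys x :
  #|[set key e | e in edges H & [&& x \in e, spread e & ~~ lead e x]]|
    <= 2 * (n ^ (d - 2) * 2 ^ k).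
Proof.
pose P1 := setX [set U : {set 'I_n} | (#|U| == d - 2) && (x \in U)]
   (\bigcup_(y in [set: 'I_n]) powerset [set z : 'I_n | blk z == blk y]).
pose P2 := setX [set U : {set 'I_n} | #|U| == d - 2]
   (powerset [set z : 'I_n | blk z == blk x]).
have le1 : #|P1| <= n ^ (d - 2) * 2 ^ k.
  rewrite cardsX; apply: (@leq_trans (#|[set U : {set 'I_n} |
     (#|U| == d - 2) && (x \in U)]| * (n * 2 ^ k))).
    rewrite leq_mul // (leq_trans (card_bigcup_le (b := 2 ^ k) _)) //.
      by move=> y _; apply: card_block_powerset.
    by rewrite cardsT card_ord.
  by rewrite mulnA leq_mul //; have := card_draws_mem x (d - 2); rewrite card_ord.
have le2 : #|P2| <= n ^ (d - 2) * 2 ^ k.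
  rewrite cardsX leq_mul ?card_block_powerset //.
  by rewrite card_draws card_ord bin_le_exp.
rewrite mul2n -addnn (leq_trans _ (leq_add le1 le2)) //.
apply: leq_trans (leq_card_setU _ _); apply/subset_leq_card/subsetP.
move=> _ /imsetP[e + ->]; rewrite inE => /and4P[eH xe te lx].
have ce := card_edge eH.
have [v lv] := lead_ex k d1 ce; have [w tw] := tail_ex k d1 ce.
have [_ _ _ _ cr] := edge_roles d1 ce lv tw.
rewrite /key te !inE /= cr eqxx /=.
have [tx|tx] := boolP (tail e x); first by rewrite (fan_sub tx) orbT.
rewrite xe lx /=; apply/orP; left; apply/bigcupP; exists w; rewrite ?inE //.
exact: fan_sub.
Qed.

(** A key led by x is determined by its rest U and the superblock s of its tail,
    because lead_blk then gives the block and x gives the fan. Since s lies above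
    all of U, the k * d sets obtained by adding to U one element of s have size
    d - 1 and determine U and s by their maximum, so those of different keys are
    different. The last superblock may stick out of 'I_n, whence the bound
    n + k * d on the ground set. *)
Lemma card_leader_keys x :
  #|[set key e | e in edges H & [&& x \in e, spread e & lead e x]]| * (k * d)
    <= 'C(n + k * d, d.-1).
Proof.
set D := k * d; have D0 : 0 < D by rewrite muln_gt0 k0; lia.
set K := [set key e | e in _ & _].
(* The elements of a fan share their superblock, which is thus the maximum. *)
pose q (c : {set 'I_n} * {set 'I_n}) := \max_(s in c.2) sblk s.
have qlt c (t : 'I_D) : q c * D + t < n + D.
  rewrite -addnS leq_add // -leq_divRL //; apply/bigmax_leqP=> s _.
  by apply: leq_div2r; apply: ltnW.
pose z c (t : 'I_D) : 'I_(n + D) := Ordinal (qlt c t).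
pose lift (c : {set 'I_n} * {set 'I_n}) : {set 'I_(n + D)} :=
  [set lshift D u | u in c.1].
pose phi (p : {set 'I_n} * {set 'I_n} * 'I_D) := z p.1 p.2 |: lift p.1.
have KP c : c \in K -> exists e w, [/\ e \in edges H, spread e, lead e x,
    tail e w & c = (rest e, fan e)].
  case/imsetP=> e; rewrite inE => /and4P[eH xe se le] ->.
  have [w tw] := tail_ex k d1 (card_edge eH).
  by exists e, w; rewrite /key se.
have qE e w : e \in edges H -> tail e w -> q (rest e, fan e) = sblk w.
  move=> eH tw; apply/eqP; rewrite eqn_leq; apply/andP; split.
    apply/bigmax_leqP=> s /=; rewrite (in_fan _ tw) => /andP[/eqP bs _].
    by rewrite (blk_sblk d bs).
  by rewrite (bigmax_sup w) //= tail_fan.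
have lift_lt c t (y : 'I_(n + D)) : c \in K -> y \in lift c -> y < z c t.
  case/KP=> e [w [eH se le tw ->]] /imsetP[u /= ur ->].
  have := rest_sblk_lt se tw ur; rewrite -(qE e w) // => lt /=.
  by apply: leq_trans (leq_addr _ _); rewrite -ltn_divLR.
have z_notin c t : c \in K -> z c t \notin lift c.
  by move=> cK; apply/negP=> /(lift_lt c t _ cK); rewrite ltnn.
rewrite -[D in X in X <= _]card_ord -cardsT -cardsX -(card_in_imset (f := phi)).
  rewrite -[X in 'C(X, _)]card_ord -card_draws.
  apply/subset_leq_card/subsetP=> _ /imsetP[[c t] + ->].
  rewrite !inE andbT => cK; have := z_notin c t cK; have := KP c cK.
  case=> e [w [eH se le tw cE]] znc; rewrite /phi /= cardsU1 znc.
  rewrite card_imset; last exact: lshift_inj.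
  rewrite cE /=; have [_ _ _ _ ->] := edge_roles d1 (card_edge eH) le tw.
  by apply/eqP; lia.
case=> [c t] [c' t']; rewrite !in_setX !in_setT !andbT /= => cK cK'.
rewrite /phi /= => eqphi.
have zz : z c t = z c' t'.
  apply/eqP; apply: contraTT (eqxx (phi (c, t))) => zz; exfalso.
  have h1 : z c t \in lift c'.
    by have := setU11 (z c t) (lift c); rewrite eqphi in_setU1 (negPf zz).
  have h2 : z c' t' \in lift c.
    by have := setU11 (z c' t') (lift c'); rewrite -eqphi in_setU1 eq_sym (negPf zz).
  have := ltn_trans (lift_lt _ t' _ cK' h1) (lift_lt _ t _ cK h2).
  by rewrite ltnn.
have eqlift : lift c = lift c'.
  by rewrite -(setU1K (z_notin c t cK)) eqphi -zz setU1K // zz z_notin.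
have eqU : c.1 = c'.1 by apply: imset_inj eqlift; apply: lshift_inj.
(* z is a quotient and a remainder modulo D *)
have [eqq eqt] : q c = q c' /\ t = t'.
  have /(congr1 val) /= := zz => eqv; split.
    have := congr1 (divn^~ D) eqv.
    by rewrite !divnMDl // !divn_small // !addn0.
  apply: val_inj; have := congr1 (modn^~ D) eqv.
  by rewrite !modnMDl !modn_small.
rewrite eqt; congr pair.
have [e [w [eH se le tw cE]]] := KP c cK.
have [e' [w' [eH' se' le' tw' cE']]] := KP c' cK'.
move: eqq eqU; rewrite cE cE' (qE _ w) // (qE _ w') //= => sw eqU.
rewrite eqU; congr pair.
have bw := lead_blk d1 (card_edge eH) se le tw (card_edge eH') le' tw' eqU sw.
have DE f u : f \in edges H -> lead f x -> tail f u -> f :\ u = x |: rest f.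
  move=> fH lf tu; rewrite (restE (card_edge fH) lf tu) setD1K //.
  apply/setD1P; split; last by case/andP: lf.
  by have [] := edge_roles d1 (card_edge fH) lf tu.
apply/setP=> y; rewrite (in_fan _ tw) (in_fan _ tw') bw.
by rewrite (DE e w) // (DE e' w') // eqU.
Qed.

Lemma lmp_le :
  lmp H <= n ^ (d - 2) * (d.-1 * (k * d)) + 2 * (n ^ (d - 2) * 2 ^ k)
           + 'C(n + k * d, d.-1) %/ (k * d).
Proof.
apply: lmp_le_keys => x.
have le3 : #|[set key e | e in edges H & [&& x \in e, spread e & lead e x]]|
    <= 'C(n + k * d, d.-1) %/ (k * d).
  by rewrite leq_divRL ?card_leader_keys // muln_gt0 k0; lia.
have le1 := leq_trans (leq_imset_card (fun e => (e, set0 : {set 'I_n})) _)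
  (card_nonspread x).
rewrite (leq_trans _ (leq_add (leq_add le1 (card_follower_keys x)) le3)) //.
rewrite (leq_trans _ (leq_add (leq_card_setU _ _) (leqnn _))) //.
apply: leq_trans (leq_card_setU _ _); apply/subset_leq_card/subsetP.
move=> _ /imsetP[e + ->]; rewrite inE => /andP[eH xe]; rewrite !in_setU.
have [se|se] := boolP (spread e).
  have [le|le] := boolP (lead e x); apply/orP.
    by right; apply: imset_f; rewrite inE eH xe se.
  by left; apply/orP; right; apply: imset_f; rewrite inE eH xe se.
apply/orP; left; apply/orP; left; rewrite /key (negPf se); apply: imset_f.
by rewrite inE eH xe.
Qed.

End Upper.

Lemma lmp_max_le d k n : 1 < d -> 0 < k ->
  lmp_max d n <= n ^ (d - 2) * (d.-1 * (k * d)) + 2 * (n ^ (d - 2) * 2 ^ k)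
                 + 'C(n + k * d, d.-1) %/ (k * d).
Proof. by move=> d1 k0; apply/bigmax_leqP=> H _; apply: lmp_le. Qed.

(** * Comparing the three parameters *)

Section Comparison.
Variables (d : nat) (T : finType) (H : uhgraph d T).

Lemma mc_le_mp : mc H <= mp H.
Proof.
rewrite /mc /mp; case: ex_minnP => c _ cmin; case: ex_minnP => w.
case/existsP=> C /andP[/andP[cov _] wC] _; apply: cmin.
by apply/existsP; exists C; rewrite cov.
Qed.

(** The weight of a partition is the sum over all vertices of the number of
    its cliques at that vertex. *)
Lemma mp_le_lmp : mp H <= #|T| * lmp H.
Proof.
rewrite /mp /lmp; case: ex_minnP => w _ wmin; case: ex_minnP => l.
case/existsP=> C /andP[part /forall_inP degC] _.
apply: leq_trans (wmin (weight C) _) _.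
  by apply/existsP; exists C; rewrite part eqxx.
rewrite /weight; under eq_bigr do rewrite -sum1_card.
rewrite (exchange_big_dep xpredT) //= -sum_nat_const leq_sum // => x _.
have [xH|xH] := boolP (x \in verts H).
  apply: leq_trans (degC x xH); rewrite -sum1_card leq_eqVlt; apply/orP; left.
  by apply/eqP/eq_bigl => K; rewrite inE.
rewrite big1 // => K /andP[KC xK]; case/negP: xH.
case/andP: part => /andP[/forall_inP/(_ K KC)/andP[_ /andP[/subsetP]]] + _ _ _.
exact.
Qed.

End Comparison.

Lemma mc_le_max d n (H : uhgraph d 'I_n) :
  verts H = [set: 'I_n] -> mc H <= mc_max d n.
Proof. by move=> vH; apply: (bigmax_sup H) => //; apply/eqP. Qed.

Lemma mc_max_le d n : mc_max d n <= mp_max d n.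
Proof.
apply/bigmax_leqP=> H vH; apply: leq_trans (mc_le_mp H) _.
exact: (bigmax_sup H).
Qed.

Lemma mp_max_le d n : mp_max d n <= n * lmp_max d n.
Proof.
apply/bigmax_leqP=> H vH; apply: leq_trans (mp_le_lmp H) _.
by rewrite card_ord leq_mul // (bigmax_sup H).
Qed.

(** * Coverings as words *)

Section Words.
Variables (d : nat) (T : finType).
Hypothesis d0 : 0 < d.
Implicit Types (V : 'I_d -> {set T}) (s : seq (T * 'I_d * bool)).

Definition insert V (p : T * 'I_d) j := if j == p.2 then p.1 |: V j else V j.

(** Reads a family of cliques from a word: a letter adds a vertex to a part of
    the current clique V, and its flag tells whether it is the last letter of
    that clique. Encoding the end of a clique by a flag, and not by a letter of
    its own, makes the length of the word equal to the weight of the family. *)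
Fixpoint decode V s : {set {set T}} :=
  if s is (p, stop) :: s' then
    if stop then transversals (insert V p) :|: decode (fun=> set0) s'
    else decode (insert V p) s'
  else set0.

(** A clique that is never closed contributes nothing, so short words can be
    padded to a fixed length. *)
Lemma decode_pad V p m : decode V (nseq m (p, false)) = set0.
Proof. by elim: m V => [|m IHm] V //=. Qed.

Lemma decode_word V l p s :
  decode V (map (pair^~ false) l ++ (p, true) :: s)
    = transversals (fun j => V j :|: [set x | (x, j) \in rcons l p])
        :|: decode (fun=> set0) s.
Proof.
have insE W q r j : W j :|: [set x | (x, j) \in q :: r]
    = insert W q j :|: [set x | (x, j) \in r].
  apply/setP=> x; rewrite /insert; case: q => y i /=.
  rewrite !inE xpair_eqE; case: (j == i); rewrite ?inE ?andbT ?andbF //=.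
  by rewrite orbCA orbA.
elim: l V => [|q l IHl] V /=; last first.
  by rewrite IHl; congr (_ :|: _); apply: eq_transversals => j; rewrite insE.
congr (_ :|: _); apply: eq_transversals => j; rewrite insE.
by apply/setP=> x; rewrite !inE orbF.
Qed.

(** The remaining word s' is arbitrary, so that words of several cliques can be
    concatenated. A clique without vertices is encoded by the empty word. *)
Lemma clique_word (K : uhgraph d T) : is_clique K ->
  exists2 s, size s = #|verts K| &
    forall s', decode (fun=> set0) (s ++ s')
                 = edges K :|: decode (fun=> set0) s'.
Proof.
case/existsP=> V /and3P[/forallP dV /eqP vK /eqP eK].
pose P := [set p : T * 'I_d | p.1 \in V p.2].
have injP : {in P &, injective fst}.
  move=> [x i] [y j]; rewrite !inE /= => xi yj eqxy; rewrite eqxy in xi *.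
  congr pair; apply/eqP/negPn/negP=> ij.
  have /forallP/(_ j)/implyP/(_ ij) := dV i.
  by move/disjointFr/(_ xi); rewrite yj.
have cP : size (enum P) = #|verts K|.
  rewrite -cardE -(card_in_imset injP) vK; apply: eq_card => x.
  apply/imsetP/bigcupP=> [[[y i] /[!inE] /= yi ->]|[i _ xi]]; first by exists i.
  by exists (x, i); rewrite ?inE.
have memP x i : (x \in V i) = ((x, i) \in enum P) by rewrite mem_enum inE.
case/lastP: (enum P) cP memP => [|l p] cP memP.
  exists [::] => // s; rewrite eK /=.
  suff -> : [set [set v i | i : 'I_d] | v : {ffun 'I_d -> T}
               & [forall i, v i \in V i]] = set0 by rewrite set0U.
  apply/setP=> e; rewrite inE; apply/imsetP=> -[v].
  by rewrite inE => /forallP/(_ (Ordinal d0)); rewrite memP.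
exists (rcons (map (pair^~ false) l) (p, true)).
  by rewrite size_rcons size_map -cP size_rcons.
move=> s; rewrite cat_rcons decode_word eK; congr (_ :|: _).
by apply: eq_transversals => j; apply/setP=> x; rewrite !inE memP.
Qed.

Lemma family_word (C : seq (uhgraph d T)) : all (@is_clique d T) C ->
  exists2 s, size s = \sum_(K <- C) #|verts K| &
    forall s', decode (fun=> set0) (s ++ s')
      = \bigcup_(K <- C) edges K :|: decode (fun=> set0) s'.
Proof.
elim: C => [_|K C IHC /= /andP[cK /IHC[s size_s decode_s]]].
  by exists [::] => [|s']; rewrite big_nil ?set0U.
have [t size_t decode_t] := clique_word cK.
exists (t ++ s) => [|s']; rewrite big_cons; first by rewrite size_cat size_t size_s.
by rewrite -catA decode_t decode_s setUA.
Qed.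

End Words.

(** Every set of d-subsets of 'I_n is the edge set of a hypergraph, hence is
    decoded from a word whose length is the largest covering weight. *)
Lemma uhgraphs_le_words d n : 0 < d -> 0 < n ->
  2 ^ 'C(n, d) <= (n * d * 2) ^ mc_max d n.
Proof.
move=> d0 n0; set W := mc_max d n.
pose X := [set decode (fun=> set0) t | t : W.-tuple ('I_n * 'I_d * bool)].
have leX : #|X| <= (n * d * 2) ^ W.
  apply: leq_trans (leq_imset_card _ _) _.
  by rewrite card_tuple !card_prod !card_ord card_bool.
apply: leq_trans leX; rewrite -[n in 'C(n, _)]card_ord -card_draws -card_powerset.
apply/subset_leq_card/subsetP=> E; rewrite powersetE => /subsetP Ed.
have EU : uniform d ([set: 'I_n], E).
  apply/forall_inP=> e eE; rewrite subsetT /=.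
  by have := Ed e eE; rewrite inE.
pose H := UHgraph EU; have := mc_le_max (erefl : verts H = setT); rewrite -/W.
rewrite /mc; case: ex_minnP => w /existsP[C /andP[/andP[cC /eqP covC] /eqP wC]] _ wW.
have [|s size_s decode_s] := @family_word d _ d0 (enum C).
  apply/allP=> K; rewrite mem_enum => KC.
  by have /andP[] := forall_inP cC K KC.
have sw : size s = w by rewrite size_s -wC /weight big_enum.
pose pad : 'I_n * 'I_d * bool := (Ordinal n0, Ordinal d0, false).
have tW : size (s ++ nseq (W - w) pad) == W.
  by rewrite size_cat size_nseq sw subnKC.
apply/imsetP; exists (Tuple tW) => //=.
by rewrite decode_s decode_pad setU0 big_enum covC.
Qed.

(** * Asymptotics *)

(* Required only here, as all_classical shadows finset lemma names. *)
From mathcomp Require Import all_order all_algebra.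
From mathcomp Require Import all_classical all_reals all_analysis.
From mathcomp Require Import ring lra.
Import Order.TTheory GRing.Theory Num.Theory.
Import numFieldNormedType.Exports.
Local Open Scope classical_set_scope.
Local Open Scope ring_scope.

Lemma trunc_log2_cvg : trunc_log 2 n @[n --> \oo] --> \oo.
Proof.
apply/cvgnyPge => A; near=> n; apply: trunc_log_max => //.
by near: n; apply: nbhs_infty_ge.
Unshelve. all: by end_near. Qed.

Section Analysis.
Variable R : realType.
Implicit Types (n L : nat).

Lemma invn_cvg (u : nat -> nat) :
  u n @[n --> \oo] --> \oo -> ((u n)%:R^-1 : R) @[n --> \oo] --> 0.
Proof.
move=> uoo; apply/gtr0_cvgV0; last by apply/cvgrnyP.
by move/cvgnyPgt/(_ 0%N): uoo; apply: filterS => n; rewrite ltr0n.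
Qed.

(** Turns a one-sided asymptotic bound into a nonnegative error term. *)
Lemma cvg_max0 (u v : nat -> R) : (\forall n \near \oo, u n <= v n) ->
  v n @[n --> \oo] --> 0 -> Num.max 0 (u n) @[n --> \oo] --> 0.
Proof.
move=> uv v0; apply: (@squeeze_cvgr _ _ _ _ (fun=> 0) (fun n => `|v n|)).
- apply: filterS uv => n uv; rewrite le_max lexx /= ge_max normr_ge0 /=.
  by rewrite (le_trans uv) ?ler_norm.
- exact: cvg_cst.
- by rewrite -(normr0 R); apply: cvg_norm.
Qed.

Lemma lg_le x y : 0 < x -> x <= y -> lg x <= lg y :> R.
Proof.
move=> x0 xy; rewrite /lg ler_pM2r ?invr_gt0 ?ln_gt0 ?ltr1n //.
by rewrite ler_ln // posrE // (lt_le_trans x0).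
Qed.

Lemma lg2X m : lg (2 ^+ m) = m%:R :> R.
Proof.
by rewrite /lg lnXn // mulrnAl divff // gt_eqF // ln_gt0 // ltr1n.
Qed.

Lemma lgM (x y : R) : 0 < x -> 0 < y -> lg (x * y) = lg x + lg y.
Proof. by move=> x0 y0; rewrite /lg lnM ?posrE // mulrDl. Qed.

Lemma lg_bounds n (L := trunc_log 2 n) : (0 < n)%N ->
  L%:R <= lg n%:R :> R /\ lg n%:R <= L%:R + 1 :> R.
Proof.
move=> n0; have /andP[le ge] := trunc_log_bounds (isT : (1 < 2)%N) n0.
split.
  by rewrite -(lg2X L) -natrX lg_le ?ltr0n ?expn_gt0 // ler_nat.
by rewrite natr1 -(lg2X L.+1) -natrX lg_le ?ltr0n // ler_nat ltnW.
Qed.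

Lemma cube_le_exp2 m : (10 <= m)%N -> (m ^ 3 <= 2 ^ m)%N.
Proof.
elim: m => // m IHm; rewrite leq_eqVlt => /predU1P[<- //|].
rewrite ltnS => m10; rewrite [leqRHS]expnS.
have le3 : (m.+1 ^ 3 <= 2 * m ^ 3)%N.
  have : (10 * (m * m) <= m * (m * m))%N by rewrite leq_mul2r m10 orbT.
  have : (10 * m <= m * m)%N by rewrite leq_mul2r m10 orbT.
  by rewrite !expnS !expn0; nia.
by rewrite (leq_trans le3) // leq_mul2l IHm.
Qed.

(** Majorant of the normalized local partition number, in terms of the inverses
    x of L and y of j, where L is the integer part of lg n and j that of lg L.
    Its three summands come from the edges meeting a superblock twice, from the
    cliques in which the given vertex is not a lead, and from those in which it
    is. *)
Definition upper_bound (d : nat) (x y : R) : R :=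
  d.-1%:R * d%:R * ((1 + x) * x) + 8 * ((1 + x) * x)
  + (1 + d%:R * x ^+ 2) ^+ d.-1 * ((1 + x) / (1 - 2 * y)) / d`!%:R.

(** The block size is k = L - 2 j: it is close to lg n, while the number 2 ^ k of
    subsets of a block is of order n / (lg n)^2 only. *)
Lemma lmp_max_upper (d n : nat) (L := trunc_log 2 n) (j := trunc_log 2 L) :
  (1 < d)%N -> (10 <= j)%N ->
  (lmp_max d n)%:R * lg n%:R / n%:R ^+ d.-1
    <= upper_bound d L%:R^-1 j%:R^-1 :> R.
Proof.
move=> d1 j10.
have dE : d.-1 = (d - 2).+1 by lia.
have L0 : (0 < L)%N by have := trunc_log_gt0 2 L; rewrite -/j; lia.
have n0 : (0 < n)%N by have := trunc_log_gt0 2 n; rewrite -/L; lia.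
have /andP[jL Lj] := trunc_log_bounds (isT : (1 < 2)%N) L0.
have /andP[Ln _] := trunc_log_bounds (isT : (1 < 2)%N) n0.
rewrite -/j -/L in jL Lj Ln.
have j3 := cube_le_exp2 j10.
have jj : (j * j <= j ^ 3)%N by rewrite !expnS; nia.
have j2L : (2 * j < L)%N by nia.
have L10 : (10 <= L)%N by lia.
have L3 := cube_le_exp2 L10.
set k := (L - 2 * j)%N; have k0 : (0 < k)%N by rewrite /k; lia.
have kL : (k <= L)%N by apply: leq_subr.
(* 2 ^ k = 2 ^ L / 4 ^ j, with L < 2 * 2 ^ j *)
have kj : (2 ^ k * L ^ 2 <= 4 * n)%N.
  apply: (@leq_trans (4 * 2 ^ L)); last by rewrite leq_mul2l.
  have -> : (2 ^ L = 2 ^ k * (2 ^ j) ^ 2)%N.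
    by rewrite -expnM -expnD; congr (2 ^ _)%N; rewrite /k; lia.
  rewrite mulnCA leq_mul2l -[4%N]/(2 ^ 2)%N -expnMn leq_exp2r //.
  by rewrite -expnS ltnW ?orbT.
have Dn : (L ^ 3 <= n)%N by apply: leq_trans L3 _.
have [lgL lgL1] := lg_bounds n0; rewrite -/L in lgL lgL1.
set l := lg _ in lgL lgL1 *.
have X0 : 0 < L%:R :> R by rewrite ltr0n.
have Y10 : 10 <= j%:R :> R by rewrite ler_nat.
have N0 : 0 < n%:R :> R by rewrite ltr0n.
have K0 : 0 < k%:R :> R by rewrite ltr0n.
set x : R := L%:R^-1; set y : R := j%:R^-1.
have x0 : 0 < x by rewrite invr_gt0.
have y1 : y <= 10^-1 by rewrite lef_pV2 ?posrE ?(lt_le_trans _ Y10).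
have xX : x * L%:R = 1 by rewrite mulVf // gt_eqF.
have X3 : L%:R ^+ 3 <= n%:R :> R by rewrite -natrX ler_nat.
have l0 : 0 <= l by apply: le_trans lgL; apply: ltW.
have Nx2 : L%:R <= x ^+ 2 * n%:R.
  have -> : L%:R = x ^+ 2 * L%:R ^+ 3 :> R.
    have -> : x ^+ 2 * L%:R ^+ 3 = (x * L%:R) ^+ 2 * L%:R by ring.
    by rewrite xX expr1n mul1r.
  by rewrite ler_pM2l ?exprn_gt0.
have lx : l <= (1 + x) * L%:R by rewrite mulrDl xX mul1r.
(* h1, h2 and h4 with hC bound the three summands of lmp_max_le, in order *)
have h1 : k%:R * l <= (1 + x) * x * n%:R.
  apply: (@le_trans _ _ (L%:R * ((1 + x) * L%:R))).
    by rewrite ler_pM ?ler0n // ler_nat.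
  rewrite mulrCA -mulrA ler_pM2l ?addr_gt0 //.
  apply: (@le_trans _ _ (L%:R * (x ^+ 2 * n%:R))); first by rewrite ler_pM2l.
  have -> : L%:R * (x ^+ 2 * n%:R) = (x * L%:R) * (x * n%:R) by ring.
  by rewrite xX mul1r.
have h2 : 2 ^+ k * l <= 4 * ((1 + x) * x) * n%:R.
  have kjR : 2 ^+ k <= 4 * x ^+ 2 * n%:R.
    have -> : 2 ^+ k = x ^+ 2 * (2 ^+ k * L%:R ^+ 2) :> R.
      have -> : x ^+ 2 * (2 ^+ k * L%:R ^+ 2) = (x * L%:R) ^+ 2 * 2 ^+ k by ring.
      by rewrite xX expr1n mul1r.
    rewrite (_ : 4 * x ^+ 2 * n%:R = x ^+ 2 * (4 * n%:R)); last by ring.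
    rewrite ler_pM2l ?exprn_gt0 //.
    by rewrite -!natrX -!natrM ler_nat.
  apply: (@le_trans _ _ (4 * x ^+ 2 * n%:R * ((1 + x) * L%:R))).
    by rewrite ler_pM // exprn_ge0.
  have -> : 4 * x ^+ 2 * n%:R * ((1 + x) * L%:R)
    = 4 * ((1 + x) * x) * n%:R * (x * L%:R) by ring.
  by rewrite xX mulr1.
have h3 : (n + k * d)%:R <= n%:R * (1 + d%:R * x ^+ 2).
  rewrite natrD natrM mulrDr mulr1 lerD2l mulrC.
  rewrite mulrCA ler_wpM2l ?ler0n // mulrC (le_trans _ Nx2) // ler_nat.
  exact: kL.
have h4 : l / k%:R <= (1 + x) / (1 - 2 * y).
  have y2 : 0 < 1 - 2 * y by lra.
  rewrite ler_pdivrMr // mulrAC ler_pdivlMr //.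
  apply: (@le_trans _ _ ((1 + x) * L%:R * (1 - 2 * y))).
    by rewrite ler_pM2r.
  rewrite -mulrA ler_pM2l ?addr_gt0 // /k natrB 1?ltnW // natrM mulrBr mulr1.
  rewrite lerD2l lerN2 mulrCA ler_pM2l // ler_pdivlMr ?(lt_le_trans _ Y10) //.
  by rewrite -natrM ler_nat (leq_trans jj) // (leq_trans j3).
have hC : 'C(n + k * d, d.-1)%:R
    <= n%:R ^+ d.-1 * (1 + d%:R * x ^+ 2) ^+ d.-1 / d.-1`!%:R :> R.
  rewrite ler_pdivlMr ?ltr0n ?fact_gt0 // -natrM bin_ffact -exprMn.
  apply: (@le_trans _ _ ((n + k * d)%:R ^+ d.-1)).
    by rewrite -natrX ler_nat ffact_le_exp.
  by rewrite lerXn2r ?nnegrE ?ler0n // mulr_ge0 ?addr_ge0 ?mulr_ge0 ?exprn_ge0 ?ler0n ?ltW.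
have D0 : 0 < (k * d)%:R :> R by rewrite ltr0n muln_gt0 k0 ltnW.
have hdiv : ('C(n + k * d, d.-1) %/ (k * d))%:R
    <= n%:R ^+ d.-1 * (1 + d%:R * x ^+ 2) ^+ d.-1 / d.-1`!%:R / (k * d)%:R :> R.
  rewrite ler_pdivlMr //; apply: le_trans hC.
  by rewrite -natrM ler_nat leq_trunc_div.
have P0 : 0 < n%:R ^+ (d - 2) :> R by rewrite exprn_gt0.
have PE : n%:R ^+ d.-1 = n%:R ^+ (d - 2) * n%:R :> R.
  by rewrite -exprSr dE.
rewrite ler_pdivrMr ?exprn_gt0 //.
have := lmp_max_le n d1 k0; rewrite -(ler_nat R) !natrD !(natrM, natrX) => hl.
apply: le_trans (ler_wpM2r l0 hl) _.
rewrite /upper_bound 2!(mulrDl _ _ l) 2!(mulrDl _ _ (n%:R ^+ d.-1)).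
apply: lerD; [apply: lerD|].
- rewrite PE.
  rewrite [leLHS](_ : _ = n%:R ^+ (d - 2) * (d.-1%:R * d%:R) * (k%:R * l)); last by ring.
  rewrite [leRHS](_ : _ = n%:R ^+ (d - 2) * (d.-1%:R * d%:R)
    * ((1 + x) * x * n%:R)); last by ring.
  by rewrite ler_wpM2l // mulr_ge0 ?mulr_ge0 ?ler0n // ltW.
- rewrite PE.
  rewrite [leLHS](_ : _ = n%:R ^+ (d - 2) * 2 * (2 ^+ k * l)); last by ring.
  rewrite [leRHS](_ : _ = n%:R ^+ (d - 2) * 2
    * (4 * ((1 + x) * x) * n%:R)); last by ring.
  by rewrite ler_wpM2l // mulr_ge0 // ltW.
- apply: le_trans (ler_wpM2r l0 hdiv) _.
  have -> : d`! = (d * d.-1`!)%N by case: (d) d1.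
  set A := (1 + d%:R * x ^+ 2) ^+ d.-1; set P := n%:R ^+ d.-1.
  have F0 : d.-1`!%:R != 0 :> R by rewrite pnatr_eq0 -lt0n fact_gt0.
  have d0 : d%:R != 0 :> R by rewrite pnatr_eq0 -lt0n ltnW.
  have kn0 : k%:R != 0 :> R by rewrite gt_eqF.
  rewrite !natrM.
  rewrite [leLHS](_ : _ = P * A / (d%:R * d.-1`!%:R) * (l / k%:R)); last first.
    by field; rewrite F0 d0 kn0.
  rewrite [leRHS](_ : _ = P * A / (d%:R * d.-1`!%:R) * ((1 + x) / (1 - 2 * y))).
    rewrite ler_wpM2l // mulr_ge0 ?invr_ge0 ?mulr_ge0 ?ler0n ?exprn_ge0 ?ler0n //.
    by rewrite addr_ge0 // mulr_ge0 ?exprn_ge0 ?ler0n // ltW.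
  by set B := _ / (1 - _); set C := _^-1; ring.
Qed.

Lemma cvg_exprn (u : nat -> R) (a : R) m :
  u n @[n --> \oo] --> a -> u n ^+ m @[n --> \oo] --> a ^+ m.
Proof.
move=> ua; apply: (@cvg_comp _ _ _ u (fun x => x ^+ m) _ (nbhs a)) => //.
exact: exprn_continuous.
Qed.

Lemma upper_bound_cvg (d : nat) (u v : nat -> R) :
  u n @[n --> \oo] --> 0 -> v n @[n --> \oo] --> 0 ->
  upper_bound d (u n) (v n) @[n --> \oo] --> (1 / d`!%:R : R).
Proof.
move=> u0 v0.
have -> : 1 / d`!%:R = upper_bound d 0 0 :> R.
  by rewrite /upper_bound !(mulr0, expr0n, addr0, add0r, subr0, expr1n, divr1, mulr1).
rewrite /upper_bound.
have u1 : (1 + u n) * u n @[n --> \oo] --> (1 + 0 : R) * 0.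
  by apply: cvgM => //; apply: cvgD => //; apply: cvg_cst.
apply: cvgD; first by apply: cvgD; apply: cvgM => //; apply: cvg_cst.
apply: cvgM; last exact: cvg_cst.
apply: cvgM.
  apply: cvg_exprn; apply: cvgD; first exact: cvg_cst.
  by apply: cvgM; [apply: cvg_cst|apply: cvg_exprn].
apply: cvgM; first by apply: cvgD => //; apply: cvg_cst.
apply: cvgV.
  by rewrite mulr0 subr0 oner_eq0.
by apply: cvgB; [apply: cvg_cst|apply: cvgM => //; apply: cvg_cst].
Qed.

Lemma lmp_max_delta d : (1 < d)%N ->
  Num.max 0 ((lmp_max d n)%:R * lg n%:R / n%:R ^+ d.-1 - 1 / d`!%:R)
    @[n --> \oo] --> (0 : R).
Proof.
move=> d1; pose L n := trunc_log 2 n.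
have Loo := trunc_log2_cvg; have LLoo := cvg_comp _ _ Loo Loo.
apply: (@cvg_max0 _ (fun n =>
  upper_bound d (L n)%:R^-1 (L (L n))%:R^-1 - 1 / d`!%:R)).
  move/cvgnyPge/(_ 10%N): LLoo; apply: filterS => n j10.
  by rewrite lerD2r; apply: lmp_max_upper.
rewrite -[X in _ --> X](subrr (1 / d`!%:R)); apply: cvgB; last exact: cvg_cst.
by apply: upper_bound_cvg; apply: invn_cvg.
Qed.

(** Minorant of the normalized covering weight, in terms of the inverses x of
    the integer part of lg n and z of n: the first factor compares binomial
    coefficients to powers, the second lg n to the number lg (2 d n) of bits per
    letter. *)
Definition lower_bound (d : nat) (x z : R) : R :=
  (1 - d%:R * z) ^+ d / d`!%:R / (1 + lg (d * 2)%:R * x).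

Lemma mc_max_lower (d n : nat) (L := trunc_log 2 n) :
  (0 < d)%N -> (d < n)%N ->
  lower_bound d L%:R^-1 n%:R^-1 <= (mc_max d n)%:R * lg n%:R / n%:R ^+ d :> R.
Proof.
move=> d0 dn; have n0 : (0 < n)%N by lia.
have L0 : (0 < L)%N by rewrite trunc_log_gt0; lia.
have [lgL _] := lg_bounds n0; rewrite -/L in lgL.
have N0 : 0 < n%:R :> R by rewrite ltr0n.
have X0 : 0 < L%:R :> R by rewrite ltr0n.
have D0 : 0 < (d * 2)%:R :> R by rewrite ltr0n muln_gt0 d0.
have l0 : 0 < lg n%:R := lt_le_trans X0 lgL.
have c0 : 0 <= lg (d * 2)%:R :> R.
  have -> : 0 = lg 1 :> R by rewrite /lg ln1 mul0r.
  by apply: lg_le => //; rewrite ler1n muln_gt0 d0.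
have words : 'C(n, d)%:R <= (mc_max d n)%:R * (lg n%:R + lg (d * 2)%:R) :> R.
  rewrite -(lg2X 'C(n, d)) -lgM // -natrM mulnA /lg mulrA ler_pM2r; last first.
    by rewrite invr_gt0 ln_gt0 // ltr1n.
  rewrite [leRHS]mulr_natl -lnXn ?ltr0n ?muln_gt0 ?n0 ?d0 //.
  rewrite ler_ln ?posrE ?exprn_gt0 ?ltr0n ?muln_gt0 ?n0 ?d0 //.
  by rewrite -!natrX ler_nat uhgraphs_le_words.
have ffact_ge : (n%:R - d%:R) ^+ d <= 'C(n, d)%:R * d`!%:R :> R.
  rewrite -natrM bin_ffact -natrB 1?ltnW // -natrX ler_nat ffact_prod.
  rewrite -[X in (_ ^ X <= _)%N]card_ord -prod_nat_const.
  by apply: leq_prod => i _; apply: leq_sub2l; apply: ltnW.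
have bin_ge : (1 - d%:R / n%:R) ^+ d / d`!%:R <= 'C(n, d)%:R / n%:R ^+ d :> R.
  rewrite ler_pdivrMr ?ltr0n ?fact_gt0 // mulrAC ler_pdivlMr ?exprn_gt0 //.
  by rewrite -exprMn mulrBl mul1r divfK ?gt_eqF.
have q0 : 0 < 1 + lg (d * 2)%:R / L%:R :> R.
  by rewrite ltr_wpDr // mulr_ge0 // invr_ge0 ltW.
rewrite /lower_bound ler_pdivrMr //; apply: le_trans bin_ge _.
rewrite mulrAC ler_pM2r ?invr_gt0 ?exprn_gt0 //; apply: le_trans words _.
rewrite -mulrA ler_wpM2l ?ler0n // mulrDr mulr1 lerD2l.
rewrite mulrCA -[leLHS]mulr1 ler_wpM2l // ler_pdivlMr // mul1r.
exact: lgL.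
Qed.

Lemma mc_max_eps d : (0 < d)%N ->
  Num.max 0 (1 / d`!%:R - (mc_max d n)%:R * lg n%:R / n%:R ^+ d)
    @[n --> \oo] --> (0 : R).
Proof.
move=> d0; pose L n := trunc_log 2 n.
apply: (@cvg_max0 _ (fun n => 1 / d`!%:R - lower_bound d (L n)%:R^-1 n%:R^-1)).
  apply: filterS (nbhs_infty_gt d) => n dn.
  by rewrite lerD2l lerN2; apply: mc_max_lower.
rewrite -[X in _ --> X](subrr (1 / d`!%:R)); apply: cvgB; first exact: cvg_cst.
have -> : 1 / d`!%:R = (1 - d%:R * 0) ^+ d / d`!%:R / (1 + lg (d * 2)%:R * 0) :> R.
  by rewrite !mulr0 subr0 addr0 expr1n divr1.
have x0 : ((L n)%:R^-1 : R) @[n --> \oo] --> 0.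
  by apply: invn_cvg; apply: trunc_log2_cvg.
have z0 : (n%:R^-1 : R) @[n --> \oo] --> 0 by apply: (@invn_cvg id); apply: cvg_id.
apply: cvgM.
  apply: cvgM; last exact: cvg_cst.
  by apply: cvg_exprn; apply: cvgB; [|apply: cvgM]; try exact: cvg_cst.
apply: cvgV; first by rewrite mulr0 addr0 oner_eq0.
by apply: cvgD; [|apply: cvgM]; try exact: cvg_cst.
Qed.

End Analysis.

Theorem mainTheorem2 (R : realType) (d : nat) (hd : (2 <= d)%N) :
  exists eps delta : nat -> R,
    [/\ eps n @[n --> \oo] --> (0 : R),
        delta n @[n --> \oo] --> (0 : R)
      & forall n : nat, (2 <= n)%N ->
        [/\ (1 / d`!%:R - eps n) * (n%:R ^+ (d - 1) / lg n%:R)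
              <= (mc_max d n)%:R / n%:R,
            (mc_max d n)%:R / n%:R <= (mp_max d n)%:R / n%:R :> R,
            (mp_max d n)%:R / n%:R <= (lmp_max d n)%:R :> R
          & (lmp_max d n)%:R
              <= (1 / d`!%:R + delta n) * (n%:R ^+ (d - 1) / lg n%:R)]].
Proof.
(* Positive parts of the deviations from 1 / d!, so the outer bounds hold for
   every n >= 2 and only the convergence is asymptotic. *)
exists (fun n => Num.max 0 (1 / d`!%:R - (mc_max d n)%:R * lg n%:R / n%:R ^+ d)).
exists (fun n =>
  Num.max 0 ((lmp_max d n)%:R * lg n%:R / n%:R ^+ d.-1 - 1 / d`!%:R)).
split; [by apply: mc_max_eps; apply: ltnW|exact: lmp_max_delta|] => n n2.
have n0 : 0 < n%:R :> R by rewrite ltr0n ltnW.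
have l0 : 0 < lg n%:R :> R.
  by rewrite /lg divr_gt0 // ln_gt0 // ?ltr1n.
rewrite subn1; split.
- rewrite mulrA ler_pdivrMr // -ler_pdivlMr ?exprn_gt0 //.
  have -> : (mc_max d n)%:R / n%:R * lg n%:R / n%:R ^+ d.-1
      = (mc_max d n)%:R * lg n%:R / n%:R ^+ d :> R.
    have -> : n%:R ^+ d = n%:R * n%:R ^+ d.-1 :> R by rewrite -exprS prednK // ltnW.
    by rewrite invfM; ring.
  by rewrite lerBlDr -lerBlDl le_max lexx orbT.
- by rewrite ler_pM2r ?invr_gt0 // ler_nat mc_max_le.
- by rewrite ler_pdivrMr // mulrC -natrM ler_nat mp_max_le.
- rewrite mulrA ler_pdivlMr // -ler_pdivrMr ?exprn_gt0 //.
  by rewrite -lerBlDl le_max lexx orbT.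
Qed.
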